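(* Let $X$ be a 4-sided thick digital disk in $\mathbb{Z}^2$, all sides of which are slanted. Let $A$ be the set of endpoints of the edges of $X$. Then $A$ is a minimal cold set for $(X,c_2)$.
   Context: Adjacencies in $\mathbb{Z}^2$: distinct points $(x_1,x_2)$, $(y_1,y_2)$ are $c_2$-adjacent if $|x_i-y_i|\le 1$ for $i=1,2$; they are $c_1$-adjacent if moreover they differ in exactly one coordinate. For $\kappa\in\{c_1,c_2\}$ and $X\subset\mathbb{Z}^2$: a $\kappa$-path of length $k$ is a sequence $x_0,\dots,x_k$ with consecutive points equal or $\kappa$-adjacent; a set is $\kappa$-connected if any two of its points are joined by a $\kappa$-path in it; $d_\kappa(x,y)$ is the minimal length of a $\kappa$-path in $X$ from $x$ to $y$. $f:X\to X$ is in $C(X,\kappa)$ (is $\kappa$-continuous) if $\kappa$-adjacent points have equal or $\kappa$-adjacent images. For $(X,\kappa)$ connected, $A\subset X$ is a cold set if every $f\in C(X,\kappa)$ with $f|_A=\mathrm{id}_A$ satisfies $d_\kappa(x,f(x))\le 1$ for all $x\in X$; a cold set $A$ is minimal if no proper subset of $A$ is a cold set for $(X,\kappa)$. A $c_2$-closed curve is a $c_2$-path $\{s_i\}_{i=0}^m$ with $s_0=s_m$ and $s_i\ne s_j$ whenever $0<|i-j|<m$. If $S\subset\mathbb{Z}^2$ is a $c_2$-closed curve such that $\mathbb{Z}^2\setminus S$ has two $c_1$-components, one finite and the other infinite, the finite one is denoted $Int(S)$ and the infinite one $Ext(S)$; then $D=S\cup Int(S)$ is a digital disk, $S$ is a bounding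 curve of $D$, and $Int(D)$ denotes $Int(S)$ when $S$ is understood. A digital line segment is a ($c_1$- or $c_2$-)connected collinear set of more than one point of $\mathbb{Z}^2$; it is horizontal or vertical (axis-parallel) or has slope $\pm1$ (slanted). The edges (sides) of $X$ are the maximal digital line segments in a bounding curve $S$ of $X$; $X$ being 4-sided with all sides slanted means it has a bounding curve made up of exactly four sides, all slanted. If edges $E_1,E_2$ of $S$ satisfy $E_1\cap E_2=\{p\}$, the interior angle at the vertex $p$ is the angle formed by $E_1$, $E_2$ and $Int(S)$. Thickness: a digital disk $X$ is thick if for some bounding curve $S$ of $X$ the following hold. (i) For every maximal slanted segment $\sigma$ of $S$ and every $p\in\sigma$ that is not an endpoint of $\sigma$, $X$ is slant-thick at $p$: there is $c\in X$ that is $c_2$-adjacent but not $c_1$-adjacent to $p$, where $c$ is the diagonal neighbor of $p$ off $\sigma$ (in the direction perpendicular to $\sigma$) on the interior side of $\sigma$. (ii) For every vertex $p$ of a $90^\circ$ interior angle $\theta$ of $S$, $X$ is $90^\circ$-thick at $p$: there is $q\in Int(X)$, in the interior of $\theta$, such that if $\theta$ has axis-parallel sides then $q$ is $c_2$-adjacent but not $c_1$-adjacent to $p$, and if $\theta$ has slanted sides then $q$ is $c_1$-adjacent to $p$. (iii) For every vertex $p$ of a $135^\circ$ interior angle $\theta$ of $S$, $X$ is $135^\circ$-thick at $p$: there are $b,b'\in X$ in the interior of $\theta$ with $b$ $c_2$-adjacent but not $c_1$-adjacent to $p$, and $b'$ $c_1$-adjacent to $p$. *)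

(* Defs.v *)
From mathcomp Require Import all_boot all_order all_algebra.
From mathcomp Require Import boolp classical_sets functions cardinality.

Set Implicit Arguments.
Unset Strict Implicit.
Unset Printing Implicit Defensive.

Import Order.TTheory GRing.Theory Num.Theory.
Local Open Scope classical_set_scope.
Local Open Scope ring_scope.

Definition Z2 : Type := (int * int)%type.

Definition c2 (p q : Z2) : bool :=
  [&& p != q, `|p.1 - q.1| <= 1 & `|p.2 - q.2| <= 1].

Definition c1 (p q : Z2) : bool :=
  c2 p q && ((p.1 != q.1) (+) (p.2 != q.2)).

(* A path of length [k] is given by a function on [nat] of which only the
   values at [0, ..., k] matter. *)
Definition kpath (kappa : rel Z2) (x : nat -> Z2) (k : nat) : Prop :=
  forall i, (i < k)%N -> x i = x i.+1 \/ kappa (x i) (x i.+1).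

Definition path_in (kappa : rel Z2) (Y : set Z2) (k : nat)
    (p q : Z2) : Prop :=
  exists x : nat -> Z2,
    [/\ kpath kappa x k, x 0%N = p, x k = q & forall i, (i <= k)%N -> Y (x i)].

Definition joined (kappa : rel Z2) (Y : set Z2) (p q : Z2) : Prop :=
  exists k, path_in kappa Y k p q.

Definition kconnected (kappa : rel Z2) (Y : set Z2) : Prop :=
  forall p q, Y p -> Y q -> joined kappa Y p q.

Definition is_dist (kappa : rel Z2) (X : set Z2) (p q : Z2)
    (d : nat) : Prop :=
  path_in kappa X d p q /\ forall d', path_in kappa X d' p q -> (d <= d')%N.

Definition component (kappa : rel Z2) (Y C : set Z2) : Prop :=
  exists2 p, Y p & C = [set q | joined kappa Y p q].

(* Maps X -> X are total functions whose values outside [X] are irrelevant. *)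
Definition kcontinuous (kappa : rel Z2) (X : set Z2)
    (f : Z2 -> Z2) : Prop :=
  (forall p, X p -> X (f p)) /\
  (forall p q, X p -> X q -> kappa p q -> f p = f q \/ kappa (f p) (f q)).

Definition cold_set (kappa : rel Z2) (X A : set Z2) : Prop :=
  [/\ kconnected kappa X, A `<=` X &
      forall f, kcontinuous kappa X f -> (forall a, A a -> f a = a) ->
        forall x, X x -> exists2 d, is_dist kappa X x (f x) d & (d <= 1)%N].

Definition minimal_cold_set (kappa : rel Z2) (X A : set Z2) : Prop :=
  cold_set kappa X A /\ forall B, B `<` A -> ~ cold_set kappa X B.

Definition closed_curve (s : nat -> Z2) (m : nat) : Prop :=
  [/\ kpath c2 s m, s 0%N = s m &
      forall i j, (i < j)%N -> (j <= m)%N -> (j - i < m)%N -> s i <> s j].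

Definition trace (s : nat -> Z2) (m : nat) : set Z2 :=
  [set p | exists2 i, (i <= m)%N & s i = p].

Definition splits_plane (S : set Z2) : Prop :=
  exists I E : set Z2,
    [/\ [set C | component c1 (~` S) C] = [set I; E],
        finite_set I & ~ finite_set E].

(* Under [splits_plane S] there is only one finite component. *)
Definition Int (S : set Z2) : set Z2 :=
  [set p | exists C, [/\ component c1 (~` S) C, finite_set C & C p]].

Definition bounding_curve (X : set Z2) (s : nat -> Z2) (m : nat) : Prop :=
  [/\ closed_curve s m, splits_plane (trace s m) &
      X = trace s m `|` Int (trace s m)].

Definition collinear (E : set Z2) : Prop :=
  exists a b c : int, (a, b) != (0, 0) /\
    forall p, E p -> a * p.1 + b * p.2 = c.

Definition digital_segment (E : set Z2) : Prop :=
  [/\ collinear E, kconnected c1 E \/ kconnected c2 E &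
      exists p q, [/\ E p, E q & p <> q]].

Definition slanted (E : set Z2) : Prop :=
  (exists c : int, forall p, E p -> p.1 - p.2 = c) \/
  (exists c : int, forall p, E p -> p.1 + p.2 = c).

(* A point of a segment is an endpoint when it is not the midpoint of two
   other points of the segment. *)
Definition endpoint (E : set Z2) (p : Z2) : Prop :=
  E p /\ ~ exists d : Z2, [/\ d != 0, E (p + d) & E (p - d)].

(* The closed curve [s] of length [m], as an [m]-periodic sequence. *)
Definition cyc (s : nat -> Z2) (m i : nat) : Z2 := s (i %% m)%N.

(* Segments run through by consecutive points of the curve, the base point
   [s 0] playing no special role. *)
Definition curve_segment (s : nat -> Z2) (m : nat) (E : set Z2) : Prop :=
  digital_segment E /\
  exists a l : nat, E = [set p | exists2 j, (j <= l)%N & cyc s m (a + j)%N = p].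

Definition edge (s : nat -> Z2) (m : nat) (E : set Z2) : Prop :=
  curve_segment s m E /\
  forall E', curve_segment s m E' -> E `<=` E' -> E' = E.

Definition four_sided (s : nat -> Z2) (m : nat) : Prop :=
  (([set E | edge s m E] : set (set Z2)) #= `I_4)%card.

Definition all_sides_slanted (s : nat -> Z2) (m : nat) : Prop :=
  forall E, edge s m E -> slanted E.

Definition edge_endpoints (s : nat -> Z2) (m : nat) : set Z2 :=
  [set p | exists2 E, edge s m E & endpoint E p].

(* [dir k] is the step to the neighbor in the direction of angle 45k degrees. *)
Definition dir (k : nat) : Z2 :=
  nth 0 [:: (1, 0); (1, 1); (0, 1); (-1, 1);
            (-1, 0); (-1, -1); (0, -1); (1, -1)] (k %% 8)%N.

(* Step from [p] to [q] crosses upwards the horizontal ray issued from [c] to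
   the right, moved up by a height less than 1 so as to avoid Z^2. *)
Definition crosses_up (c p q : Z2) : bool :=
  [&& p.2 == c.2, q.2 == c.2 + 1 & c.1 < p.1].

Definition winding (s : nat -> Z2) (m : nat) (c : Z2) : int :=
  (\sum_(i < m) crosses_up c (s i) (s i.+1))%N%:Z -
  (\sum_(i < m) crosses_up c (s i.+1) (s i))%N%:Z.

Definition counterclockwise (s : nat -> Z2) (m : nat) : Prop :=
  forall c, Int (trace s m) c -> 0 < winding s m c.

(* For a counterclockwise curve, Int(S) lies to the left.  The interior angle
   at a vertex [p] is therefore swept counterclockwise from the ray along the
   edge by which the curve leaves [p] to the ray along the edge by which it
   arrives.  Below, these rays have directions [dir k] and [dir (k + n)], and
   the angle measures 45n degrees. *)
Definition interior_angle (s : nat -> Z2) (m : nat) (p : Z2)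
    (k n : nat) : Prop :=
  (0 < n < 8)%N /\
  exists (i : nat) (E1 E2 : set Z2),
    [/\ edge s m E1, edge s m E2 & E1 `&` E2 = [set p]] /\
    [/\ E1 (cyc s m i), E2 (cyc s m i.+2), cyc s m i.+1 = p,
        cyc s m i.+2 = p + dir k & cyc s m i = p + dir (k + n)%N].

(* The c_2-neighbors of [p] in the interior of that angle. *)
Definition in_angle (p : Z2) (k n : nat) (q : Z2) : Prop :=
  exists2 j, (0 < j < n)%N & q = p + dir (k + j)%N.

Definition diag_adj (p q : Z2) : bool := c2 p q && ~~ c1 p q.

Definition axis_parallel (d : Z2) : bool := (d.1 == 0) || (d.2 == 0).

(* [p + dir (k + 2)] is the neighbor of [p] to the left, at a right angle, of
   the direction [dir k] in which the curve leaves [p]. *)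
Definition slant_thick_at (X : set Z2) (s : nat -> Z2) (m : nat)
    (sigma : set Z2) (p : Z2) : Prop :=
  exists c, [/\ X c, diag_adj p c, ~ sigma c &
    exists i k, [/\ cyc s m i.+1 = p, cyc s m i.+2 = p + dir k &
                    c = p + dir (k + 2)%N]].

Definition thick_90_at (s : nat -> Z2) (m : nat) (p : Z2)
    (k : nat) : Prop :=
  exists q, [/\ Int (trace s m) q, in_angle p k 2 q &
    if axis_parallel (dir k) then diag_adj p q else c1 p q].

Definition thick_135_at (X : set Z2) (p : Z2) (k : nat) : Prop :=
  exists b b', [/\ X b, in_angle p k 3 b & diag_adj p b] /\
               [/\ X b', in_angle p k 3 b' & c1 p b'].

(* Asking for a counterclockwise curve only fixes the direction of travel: a
   curve and its reverse have the same trace. *)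
Definition thick (X : set Z2) : Prop :=
  exists (s : nat -> Z2) (m : nat),
    [/\ bounding_curve X s m, counterclockwise s m &
      [/\ forall sigma p, edge s m sigma -> slanted sigma ->
            sigma p -> ~ endpoint sigma p -> slant_thick_at X s m sigma p,
          forall p k, interior_angle s m p k 2 -> thick_90_at s m p k &
          forall p k, interior_angle s m p k 3 -> thick_135_at X p k]].

(* Main.v *)
(* In the coordinates U = x + y and V = x - y every step of the curve changes
   exactly one of U, V, since its edge is slanted.  Each of max U, min U, max V,
   min V is attained along an edge, so these are the four edges and the curve
   runs along four bounding lines; as it never turns back, it runs once around
   the boundary of the rectangle u0 <= U <= u1, v0 <= V <= v1, and X is that
   rectangle.

   A continuous self-map is nonexpansive for the path distance, so on a straight
   segment between two fixed points it preserves every coordinate that varies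
   along the segment.  Fixing the corners therefore fixes the sides, and then,
   along rows and columns, all of X.  Conversely, moving a single corner two
   units inwards is continuous, so no corner can be omitted. *)
Require Import Defs.
From mathcomp Require Import all_boot all_order all_algebra.
From mathcomp Require Import boolp classical_sets functions cardinality.
From mathcomp Require Import zify.

Set Implicit Arguments.
Unset Strict Implicit.
Unset Printing Implicit Defensive.

Import Order.TTheory GRing.Theory Num.Theory.
Local Open Scope classical_set_scope.
Local Open Scope ring_scope.

(** * Paths, and nonexpansiveness of continuous maps *)

Lemma Z2_eq (p q : Z2) : p.1 = q.1 -> p.2 = q.2 -> p = q.
Proof. by case: p q => [a b] [c d] /= -> ->. Qed.

Lemma Z2_neq (p q : Z2) : p <> q -> p.1 <> q.1 \/ p.2 <> q.2.
Proof.
move=> neq; have [e1|/eqP ne1] := eqVneq p.1 q.1; last by left.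
by right=> e2; apply: neq; apply: Z2_eq.
Qed.

Lemma c2P (p q : Z2) :
  c2 p q <-> [/\ p <> q, `|p.1 - q.1| <= 1 & `|p.2 - q.2| <= 1].
Proof. by split=> [/and3P[/eqP ? ? ?] | [/eqP ? ? ?]] //; apply/and3P. Qed.

Lemma joined_refl kappa (Y : set Z2) p : Y p -> joined kappa Y p p.
Proof. by move=> Yp; exists 0%N, (fun=> p). Qed.

Lemma joined_trans kappa (Y : set Z2) q p r :
  joined kappa Y p q -> joined kappa Y q r -> joined kappa Y p r.
Proof.
move=> [k [x [px x0 xk Yx]]] [l [y [py y0 yl Yy]]].
exists (k + l)%N, (fun i => if (i <= k)%N then x i else y (i - k)%N); split.
- move=> i ltikl; have [ltik|lekj] := ltnP i k.
    by rewrite (ltnW ltik); apply: px.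
  have -> : (if (i <= k)%N then x i else y (i - k)%N) = y (i - k)%N.
    case: leqP => // leik.
    by rewrite (_ : i = k) ?subnn ?xk ?y0 //; apply/eqP; rewrite eqn_leq leik.
  by rewrite subSn //; apply: py; rewrite ltn_subLR.
- by rewrite leq0n.
- case: leqP => [|_]; last by rewrite addKn.
  rewrite -[leqRHS]addn0 leq_add2l leqn0 => /eqP l0.
  by rewrite l0 addn0 xk -y0 -l0.
- move=> i leikl; case: leqP => [|ltki]; first exact: Yx.
  by apply: Yy; rewrite leq_subLR.
Qed.

Lemma path_in_line (X : set Z2) (d p : Z2) (k : int) :
    0 <= k -> `|d.1| <= 1 -> `|d.2| <= 1 ->
    (forall i : int, 0 <= i <= k -> X (p.1 + d.1 * i, p.2 + d.2 * i)) ->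
  path_in c2 X `|k|%N p (p.1 + d.1 * k, p.2 + d.2 * k).
Proof.
case: k => // k _ d1 d2 Xp.
exists (fun i : nat => (p.1 + d.1 * i%:Z, p.2 + d.2 * i%:Z)); split=> //.
- move=> i _; have [->|/eqP neq] := eqVneq (p.1 + d.1 * i%:Z, p.2 + d.2 * i%:Z)
    (p.1 + d.1 * i.+1%:Z, p.2 + d.2 * i.+1%:Z); [by left | right].
  by apply/c2P; split=> //=; rewrite -addn1 PoszD; lia.
- by apply: Z2_eq; rewrite /= mulr0 addr0.
- by move=> i leik; apply: Xp; lia.
Qed.

(** Each step of the path is sent to equal or adjacent points, so each coordinate changes by at most
    1 per step. *)
Lemma kcontinuous_nonexpansive (X : set Z2) f k p q :
    kcontinuous c2 X f -> path_in c2 X k p q ->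
  `|(f p).1 - (f q).1| <= k%:Z /\ `|(f p).2 - (f q).2| <= k%:Z.
Proof.
move=> [_ fc] [x [px <- <- Xx]].
elim: k px Xx => [|k IH] px Xx; first lia.
have [||d1 d2] := IH; first by move=> i /ltnW; apply: px.
  by move=> i /leqW; apply: Xx.
have : f (x k) = f (x k.+1) \/ c2 (f (x k)) (f (x k.+1)).
  have [->|adj] := px k (ltnSn k); first by left.
  by apply: fc => //; apply: Xx.
by case=> [<-|/c2P[_ e1 e2]]; lia.
Qed.

Lemma path_in_dist (X : set Z2) k p q : path_in c2 X k p q ->
  `|p.1 - q.1| <= k%:Z /\ `|p.2 - q.2| <= k%:Z.
Proof.
by apply: (@kcontinuous_nonexpansive X id); split=> // ? ? _ _ ?; right.
Qed.


Lemma joined_line (X : set Z2) (p d : Z2) (k : int) (q : Z2) :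
    0 <= k -> `|d.1| <= 1 -> `|d.2| <= 1 ->
    (forall i : int, 0 <= i <= k -> X (p.1 + d.1 * i, p.2 + d.2 * i)) ->
    q = (p.1 + d.1 * k, p.2 + d.2 * k) ->
  joined c2 X p q.
Proof. by move=> k0 d1 d2 Xp ->; exists `|k|%N; apply: path_in_line. Qed.

Lemma c2_sym (p q : Z2) : c2 p q = c2 q p.
Proof. by rewrite /c2 eq_sym distrC [`|p.2 - _|]distrC. Qed.

Lemma joined_sym (X : set Z2) (p q : Z2) : joined c2 X p q -> joined c2 X q p.
Proof.
move=> [k [x [px <- <- Xx]]]; exists k, (fun i => x (k - i)%N).
split; rewrite ?subnn ?subn0 //; last by move=> i _; apply/Xx/leq_subr.
move=> i ltik; rewrite c2_sym.
have := px (k - i.+1)%N; rewrite -subSn // subSS => /(_ (leq_subr _ _)).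
by case=> [->|]; [left|right].
Qed.

(* The image of [p] is squeezed between two fixed points at the maximal
   distance that continuity allows. *)
Lemma fixed_between (X : set Z2) f (p d : Z2) (k l : int) :
    kcontinuous c2 X f -> 0 <= k -> 0 <= l -> `|d.1| <= 1 -> `|d.2| <= 1 ->
    (forall i : int, - k <= i <= l -> X (p.1 + d.1 * i, p.2 + d.2 * i)) ->
    let a := (p.1 - d.1 * k, p.2 - d.2 * k) in
    let b := (p.1 + d.1 * l, p.2 + d.2 * l) in
    f a = a -> f b = b ->
  (d.1 != 0 -> (f p).1 = p.1) /\ (d.2 != 0 -> (f p).2 = p.2).
Proof.
move=> fc k0 l0 d1 d2 Xp a b fa fb.
have near (e : Z2) (j : int) : 0 <= j -> `|e.1| <= 1 -> `|e.2| <= 1 ->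
    (forall i : int, 0 <= i <= j -> X (p.1 + e.1 * i, p.2 + e.2 * i)) ->
    let c := (p.1 + e.1 * j, p.2 + e.2 * j) in
    f c = c -> `|(f p).1 - c.1| <= j /\ `|(f p).2 - c.2| <= j.
  move=> j0 e1 e2 Xe c fc'.
  have := kcontinuous_nonexpansive fc (path_in_line j0 e1 e2 Xe).
  by rewrite -/c fc'; case: (j) j0 => //.
have [|||||b1 b2] := near d l => //; first by move=> i hi; apply: Xp; lia.
have [|||||a1 a2] := near (- d.1, - d.2) k => //=; try lia.
- move=> i hi; have := Xp (- i) ltac:(lia).
  by rewrite !mulrN !mulNr.
- by rewrite !mulNr.
rewrite /= in a1 a2 b1 b2.
split=> dn0.
- have [e|e] : d.1 = 1 \/ d.1 = -1 by lia.
  + by rewrite e in a1 b1; lia.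
  + by rewrite e in a1 b1; lia.
- have [e|e] : d.2 = 1 \/ d.2 = -1 by lia.
  + by rewrite e in a2 b2; lia.
  + by rewrite e in a2 b2; lia.
Qed.

(** * The slanted rectangle and its corners *)

Definition rectangle (u0 u1 v0 v1 : int) : set Z2 :=
  [set p | u0 <= p.1 + p.2 <= u1 /\ v0 <= p.1 - p.2 <= v1].

Definition corners (u0 u1 v0 v1 : int) : set Z2 :=
  [set p | (p.1 + p.2 = u0 \/ p.1 + p.2 = u1) /\
           (p.1 - p.2 = v0 \/ p.1 - p.2 = v1)].

Section Rectangle.

Context (u0 u1 v0 v1 : int) (ltu : u0 < u1) (ltv : v0 < v1).
(** U = x + y and V = x - y have equal parity at integer points, so these four hypotheses amount to
    [u0], [u1], [v0], [v1] having the same parity. *)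
Context (left_corner : exists p : Z2, p.1 + p.2 = u0 /\ p.1 - p.2 = v0).
Context (right_corner : exists p : Z2, p.1 + p.2 = u1 /\ p.1 - p.2 = v1).
Context (top_corner : exists p : Z2, p.1 + p.2 = u1 /\ p.1 - p.2 = v0).
Context (bottom_corner : exists p : Z2, p.1 + p.2 = u0 /\ p.1 - p.2 = v1).

Let X := rectangle u0 u1 v0 v1.
Let A := corners u0 u1 v0 v1.

(** From any point, walk left until one of the two sides through the left corner is met, then follow
    that side to the corner. *)
Lemma rectangle_connected : kconnected c2 X.
Proof.
have [w [wu wv]] := left_corner.
suff toleft p : X p -> joined c2 X p w.
  by move=> p q /toleft pw /toleft /joined_sym; apply: joined_trans pw.
move=> [/= pU pV].
(* The row meets U = u0 at x = u0 - y and V = v0 at x = v0 + y; the larger abscissa comes first. *)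
have [le|lt] := leP (v0 + p.2) (u0 - p.2).
- apply: (@joined_trans _ _ (u0 - p.2, p.2)).
    apply: (@joined_line _ _ (-1, 0) (p.1 - (u0 - p.2))) => //=; first lia.
      by move=> i hi; split=> /=; lia.
    by apply: Z2_eq => /=; lia.
  apply: (@joined_line _ _ (-1, 1) (u0 - p.2 - w.1)) => //=; first lia.
    by move=> i hi; split=> /=; lia.
  by apply: Z2_eq => /=; lia.
- apply: (@joined_trans _ _ (v0 + p.2, p.2)).
    apply: (@joined_line _ _ (-1, 0) (p.1 - (v0 + p.2))) => //=; first lia.
      by move=> i hi; split=> /=; lia.
    by apply: Z2_eq => /=; lia.
  apply: (@joined_line _ _ (-1, -1) (v0 + p.2 - w.1)) => //=; first lia.
    by move=> i hi; split=> /=; lia.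
  by apply: Z2_eq => /=; lia.
Qed.

Lemma corners_freeze f : kcontinuous c2 X f -> (forall a, A a -> f a = a) ->
  forall p, X p -> f p = p.
Proof.
move=> fc fA.
have [w [wu wv]] := left_corner; have [e [eu ev]] := right_corner.
have [n [nu nv]] := top_corner; have [s [su sv]] := bottom_corner.
have fixU u p (a b : Z2) : u = u0 \/ u = u1 -> X p -> p.1 + p.2 = u ->
    a.1 + a.2 = u -> a.1 - a.2 = v0 -> b.1 + b.2 = u -> b.1 - b.2 = v1 ->
    f p = p.
  move=> hu [/= pU pV] pu au av bu bv.
  have [||||||||h1 h2] := @fixed_between X f p (1, -1) (p.1 - a.1) (b.1 - p.1);
    rewrite ?mul1r //; try lia.
  - by move=> i /= hi; split=> /=; lia.
  - by apply: fA; split=> /=; lia.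
  - by apply: fA; split=> /=; lia.
  - by apply: Z2_eq; [apply: h1|apply: h2].
have fixV v p (a b : Z2) : v = v0 \/ v = v1 -> X p -> p.1 - p.2 = v ->
    a.1 - a.2 = v -> a.1 + a.2 = u0 -> b.1 - b.2 = v -> b.1 + b.2 = u1 ->
    f p = p.
  move=> hv [/= pU pV] pv av au bv bu.
  have [||||||||h1 h2] := @fixed_between X f p (1, 1) (p.1 - a.1) (b.1 - p.1);
    rewrite ?mul1r //; try lia.
  - by move=> i /= hi; split=> /=; lia.
  - by apply: fA; split=> /=; lia.
  - by apply: fA; split=> /=; lia.
  - by apply: Z2_eq; [apply: h1|apply: h2].
have fix_side p : X p ->
    p.1 + p.2 = u0 \/ p.1 + p.2 = u1 \/ p.1 - p.2 = v0 \/ p.1 - p.2 = v1 ->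
    f p = p.
  move=> Xp [pb|[pb|[pb|pb]]].
  - by apply: (fixU u0 p w s) => //; left.
  - by apply: (fixU u1 p n e) => //; right.
  - by apply: (fixV v0 p w n) => //; left.
  - by apply: (fixV v1 p s e) => //; right.
(* Every row and every column of the rectangle ends in points of its sides,
   since it meets the bounding lines in integer points. *)
move=> p Xp; have [/= pU pV] := Xp; apply: Z2_eq.
(* A step left lowers U and V by 1, a step down lowers U and raises V; so [k] and [l], here and for
   the column, count the steps to the first bounding line met. *)
- pose k := Num.min (p.1 + p.2 - u0) (p.1 - p.2 - v0).
  pose l := Num.min (u1 - (p.1 + p.2)) (v1 - (p.1 - p.2)).
  have [||||||||h1 _] := @fixed_between X f p (1, 0) k l;
    rewrite ?mul1r /= ?mul0r //; try (rewrite /k /l; lia).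
  - by move=> i /= hi; split=> /=; rewrite /k /l in hi; lia.
  - by apply: fix_side; [split|]; rewrite /= /k; lia.
  - by apply: fix_side; [split|]; rewrite /= /l; lia.
  - exact: h1.
- pose k := Num.min (p.1 + p.2 - u0) (v1 - (p.1 - p.2)).
  pose l := Num.min (u1 - (p.1 + p.2)) (p.1 - p.2 - v0).
  have [||||||||_ h2] := @fixed_between X f p (0, 1) k l;
    rewrite ?mul1r /= ?mul0r //; try (rewrite /k /l; lia).
  - by move=> i /= hi; split=> /=; rewrite /k /l in hi; lia.
  - by apply: fix_side; [split|]; rewrite /= /k; lia.
  - by apply: fix_side; [split|]; rewrite /= /l; lia.
  - exact: h2.
Qed.

(* [b] lies two steps inwards from the corner [a]. *)
Lemma corner_movable a : A a -> exists b,
  [/\ X b, b.1 = a.1 + 2 \/ b.1 = a.1 - 2 \/ b.2 = a.2 + 2 \/ b.2 = a.2 - 2 &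
      forall p, X p -> p <> a -> c2 p a -> p = b \/ c2 p b].
Proof.
have [w [wu wv]] := left_corner; have [e [eu ev]] := right_corner.
have [n [nu nv]] := top_corner; have [s [su sv]] := bottom_corner.
have move_to (b : Z2) : X b ->
    b.1 = a.1 + 2 \/ b.1 = a.1 - 2 \/ b.2 = a.2 + 2 \/ b.2 = a.2 - 2 ->
    (forall p : Z2, X p -> `|p.1 - a.1| <= 1 -> `|p.2 - a.2| <= 1 ->
      p.1 <> a.1 \/ p.2 <> a.2 -> `|p.1 - b.1| <= 1 /\ `|p.2 - b.2| <= 1) ->
    exists b, [/\ X b,
      b.1 = a.1 + 2 \/ b.1 = a.1 - 2 \/ b.2 = a.2 + 2 \/ b.2 = a.2 - 2 &
      forall p, X p -> p <> a -> c2 p a -> p = b \/ c2 p b].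
  move=> Xb ab bP; exists b; split=> // p Xp /Z2_neq pa /c2P[_ h1 h2].
  have [->|/eqP pb] := eqVneq p b; [by left | right].
  by apply/c2P; split=> //; have [] := bP p Xp h1 h2 pa.
move=> [/= [aU|aU] [aV|aV]].
(* By parity, opposite sides are at least 2 apart in U and in V, so the target is in the rectangle.
   The cases are the left, bottom, top and right corners. *)
- apply: (move_to (a.1 + 2, a.2)); first by split=> /=; lia.
    by left.
  by move=> p [/= pU pV]; lia.
- apply: (move_to (a.1, a.2 + 2)); first by split=> /=; lia.
    by right; right; left.
  by move=> p [/= pU pV]; lia.
- apply: (move_to (a.1, a.2 - 2)); first by split=> /=; lia.
    by right; right; right.
  by move=> p [/= pU pV]; lia.
- apply: (move_to (a.1 - 2, a.2)); first by split=> /=; lia.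
    by right; left.
  by move=> p [/= pU pV]; lia.
Qed.

Lemma rectangle_minimal_cold : minimal_cold_set c2 X A.
Proof.
split.
  split; first exact: rectangle_connected.
    by move=> p [/= pU pV]; split=> /=; lia.
  move=> f fc fA p Xp; exists 0%N => //.
  by rewrite (corners_freeze fc fA Xp); split=> //; exists (fun=> p).
move=> B [BA /existsNP[a /not_implyP[Aa nBa]]] [_ _ coldB].
have Xa : X a by case: Aa => /= pU pV; split=> /=; lia.
have [b [Xb ab bP]] := corner_movable Aa.
(* Moving only the missing corner [a] fixes all of [B], but displaces [a] by 2 in some
   coordinate. *)
pose f p := if p == a then b else p.
have fa : f a = b by rewrite /f eqxx.
have fneq p : p <> a -> f p = p by rewrite /f => /eqP/negPf ->.
have fc : kcontinuous c2 X f.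
  split=> [p Xp|p q Xp Xq pq]; first by rewrite /f; case: ifP.
  have [pa|/eqP pa] := eqVneq p a; have [qa|/eqP qa] := eqVneq q a.
  - by left; rewrite pa qa.
  - rewrite pa fa fneq // c2_sym.
    by have [|->|] := bP q Xq qa; [rewrite c2_sym -pa|left|right].
  - by rewrite qa fa fneq //; apply: bP; rewrite // -qa.
  - by right; rewrite !fneq.
have [a' Ba'|d [pd _] led1] := coldB f fc _ a Xa.
  by apply: fneq => eqa; apply: nBa; rewrite -eqa.
by have := path_in_dist pd; rewrite fa; lia.
Qed.

End Rectangle.

(** * Finite components of a complement *)

Lemma joined_step (kappa : rel Z2) (Y : set Z2) (p q : Z2) :
  Y p -> Y q -> kappa p q -> joined kappa Y p q.
Proof.
move=> Yp Yq pq; exists 1%N, (fun i => if i == 0%N then p else q).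
split=> //; first by case=> // _; right.
by move=> i _; case: ifP.
Qed.

Lemma joined_end kappa (Y : set Z2) (p q : Z2) : joined kappa Y p q -> Y q.
Proof. by move=> [k [x [_ _ <- Yx]]]; apply: Yx. Qed.

Lemma c1_unit_step (p d : Z2) (k : int) : `|d.1| + `|d.2| = 1 ->
  c1 (p.1 + d.1 * k, p.2 + d.2 * k) (p.1 + d.1 * (k + 1), p.2 + d.2 * (k + 1)).
Proof.
move=> d1; have h : d.1 = 0 /\ (d.2 = 1 \/ d.2 = -1) \/
  d.2 = 0 /\ (d.1 = 1 \/ d.1 = -1) by lia.
rewrite /c1 /c2 -pair_eqE /=.
by case: h => -[-> [->|->]]; lia.
Qed.

(** The ray joins [q] to infinitely many points, so its component is infinite. The condition on [d]
    singles out the four axis directions. *)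
Lemma ray_not_Int (S : set Z2) (q d : Z2) : `|d.1| + `|d.2| = 1 ->
  (forall k : nat, ~ S (q.1 + d.1 * k%:Z, q.2 + d.2 * k%:Z)) -> ~ Int S q.
Proof.
move=> d1 Sq [C [[p Sp ->] finC pq]]; apply: infinite_nat.
pose r (k : nat) : Z2 := (q.1 + d.1 * k%:Z, q.2 + d.2 * k%:Z).
have r_inj : injective r.
  move=> i j rij; have /= e1 := congr1 fst rij; have /= e2 := congr1 snd rij.
  have d_unit : (d.1 = 1 \/ d.1 = -1) \/ (d.2 = 1 \/ d.2 = -1) by lia.
  by case: d_unit => -[] e; rewrite e in e1 e2; lia.
have r_joined k : joined c1 (~` S) p (r k).
  elim: k => [|k IH]; first by rewrite /r !mulr0 !addr0 -surjective_pairing.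
  apply: joined_trans IH _; apply: joined_step; [exact: Sq|exact: Sq|].
  by rewrite /r -addn1 PoszD; apply: c1_unit_step.
apply: sub_finite_set (finite_preimage (in2W r_inj) finC) => k _.
exact: r_joined.
Qed.

Lemma Int_nonempty (S : set Z2) : splits_plane S -> exists p, Int S p.
Proof.
move=> [I [E [components finI _]]].
have [p Sp defI] : component c1 (~` S) I.
  by rewrite -[component _ _ _]/([set C | component c1 (~` S) C] I) components; left.
exists p, I; split=> //; first by exists p.
by rewrite defI; apply: joined_refl.
Qed.

Lemma Int_outside (S : set Z2) p : Int S p -> ~ S p.
Proof. by move=> [C [[q _ ->] _ /joined_end]]. Qed.

(** * The boundary of the rectangle *)

Definition rectangle_boundary (u0 u1 v0 v1 : int) : set Z2 :=
  [set p | rectangle u0 u1 v0 v1 p /\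
    (p.1 + p.2 = u0 \/ p.1 + p.2 = u1 \/ p.1 - p.2 = v0 \/ p.1 - p.2 = v1)].

Lemma finite_rectangle u0 u1 v0 v1 : finite_set (rectangle u0 u1 v0 v1).
Proof.
(* As 2x = U + V and 2y = U - V, both coordinates are at most [M] in absolute value. *)
pose M : int := `|u0| + `|u1| + `|v0| + `|v1|; pose N := (`|M|.*2.+1)%N.
pose f (k : nat * nat) : Z2 := (k.1%:Z - M, k.2%:Z - M).
apply: sub_finite_set (finite_image f (finite_setX (finite_II N) (finite_II N))).
move=> p [/= pU pV].
have M1 : `|p.1| <= M by rewrite /M; lia.
have M2 : `|p.2| <= M by rewrite /M; lia.
exists (`|(p.1 + M)%R|%N, `|(p.2 + M)%R|%N); last by apply: Z2_eq => /=; lia.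
by rewrite /N; split=> /=; lia.
Qed.

(** A point outside the closed rectangle escapes along a horizontal ray that only moves further
    away. From inside, a [c1]-step changes each of U and V by exactly 1, so it cannot leave the open
    rectangle without landing on the boundary. *)
Lemma Int_rectangle_boundary u0 u1 v0 v1 p :
  Int (rectangle_boundary u0 u1 v0 v1) p <->
  u0 < p.1 + p.2 < u1 /\ v0 < p.1 - p.2 < v1.
Proof.
set S := rectangle_boundary _ _ _ _; split=> [Ip|[pU pV]].
  have nSp := Int_outside Ip.
  have outside (d : Z2) : `|d.1| + `|d.2| = 1 ->
      (forall k : nat, ~ S (p.1 + d.1 * k%:Z, p.2 + d.2 * k%:Z)) -> False.
    by move=> d1 Sd; apply: ray_not_Int Ip; eassumption.
  have [pU0|pU0] := ltP (p.1 + p.2) u0.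
    by exfalso; apply: (outside (-1, 0)) => // k [[/= ? ?] _]; lia.
  have [pU1|pU1] := ltP u1 (p.1 + p.2).
    by exfalso; apply: (outside (1, 0)) => // k [[/= ? ?] _]; lia.
  have [pV0|pV0] := ltP (p.1 - p.2) v0.
    by exfalso; apply: (outside (-1, 0)) => // k [[/= ? ?] _]; lia.
  have [pV1|pV1] := ltP v1 (p.1 - p.2).
    by exfalso; apply: (outside (1, 0)) => // k [[/= ? ?] _]; lia.
  have : ~ (p.1 + p.2 = u0 \/ p.1 + p.2 = u1 \/ p.1 - p.2 = v0 \/ p.1 - p.2 = v1).
    by move=> e; apply: nSp; split=> //; split=> /=; lia.
  by lia.
exists [set q | joined c1 (~` S) p q]; split; last first.
- by apply: joined_refl => -[_] /=; lia.
- apply: sub_finite_set (finite_rectangle u0 u1 v0 v1) => q [k [x [px x0 <- Sx]]].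
  suff: u0 < (x k).1 + (x k).2 < u1 /\ v0 < (x k).1 - (x k).2 < v1.
    by move=> ?; split=> /=; lia.
  elim: k px Sx => [|k IH] px Sx; first by rewrite x0.
  have [|| xU xV] := IH.
  + by move=> i /ltnW; apply: px.
  + by move=> i /leqW; apply: Sx.
  have nS : ~ S (x k.+1) by apply: (Sx _ (leqnn _)).
  have [<-//|/andP[/c2P[_ d1 d2] c]] := px k (ltnSn k).
  apply: contrapT => out; apply: nS.
  have h : (x k).1 = (x k.+1).1 \/ (x k).2 = (x k.+1).2 by lia.
  by split; [split|]; move=> /=; lia.
- by exists p => //; move=> [_] /=; lia.
Qed.

(* Neighbors in the cycle formed by the boundary of the rectangle; when the
   rectangle is thin, diagonal adjacency alone would also join opposite sides. *)
Definition boundary_step (u0 u1 v0 v1 : int) (p q : Z2) : Prop :=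
  rectangle u0 u1 v0 v1 q /\
  ((p.1 + p.2 = q.1 + q.2 /\ (p.1 + p.2 = u0 \/ p.1 + p.2 = u1) /\
    (p.1 - q.1 = 1 \/ p.1 - q.1 = -1)) \/
   (p.1 - p.2 = q.1 - q.2 /\ (p.1 - p.2 = v0 \/ p.1 - p.2 = v1) /\
    (p.1 - q.1 = 1 \/ p.1 - q.1 = -1))).

(** Between corners, the two neighbors lie along the same side; at a corner, each of its two sides
    offers one neighbor, the opposite step leaving the rectangle. *)
Lemma boundary_step_two u0 u1 v0 v1 (p a b q : Z2) : u0 < u1 -> v0 < v1 ->
    rectangle u0 u1 v0 v1 p ->
    boundary_step u0 u1 v0 v1 p a -> boundary_step u0 u1 v0 v1 p b -> a <> b ->
  boundary_step u0 u1 v0 v1 p q -> q = a \/ q = b.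
Proof.
move=> ltu ltv [/= /andP[pu0 pu1] /andP[pv0 pv1]].
move=> [[/= /andP[au0 au1] /andP[av0 av1]] pa].
move=> [[/= /andP[bu0 bu1] /andP[bv0 bv1]] pb] /Z2_neq ab.
move=> [[/= /andP[qu0 qu1] /andP[qv0 qv1]] pq].
have : (q.1 = a.1 /\ q.2 = a.2) \/ (q.1 = b.1 /\ q.2 = b.2).
  by case: pa => -[a1 [a2 [a3|a3]]]; case: pb => -[b1 [b2 [b3|b3]]];
    case: pq => -[q1 [q2 [q3|q3]]]; lia.
move=> [[? ?]|[? ?]].
- by left; apply: Z2_eq.
- by right; apply: Z2_eq.
Qed.

(** The boundary is a single cycle: a side leads from the given point to a corner, sides lead on to
    further corners, and every side has an end among the corners reached. *)
Lemma boundary_saturated u0 u1 v0 v1 (T : set Z2) : u0 < u1 -> v0 < v1 ->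
    (exists p : Z2, p.1 + p.2 = u0 /\ p.1 - p.2 = v0) ->
    (exists p : Z2, p.1 + p.2 = u1 /\ p.1 - p.2 = v1) ->
    (exists p : Z2, p.1 + p.2 = u1 /\ p.1 - p.2 = v0) ->
    (exists p : Z2, p.1 + p.2 = u0 /\ p.1 - p.2 = v1) ->
    (forall p q, T p -> boundary_step u0 u1 v0 v1 p q -> T q) ->
    (exists p, T p /\ rectangle_boundary u0 u1 v0 v1 p) ->
  rectangle_boundary u0 u1 v0 v1 `<=` T.
Proof.
move=> ltu ltv [w [wu wv]] [e [eu ev]] [n [nu nv]] [s [su sv]] Tstep [o [To bo]].
have side (p q : Z2) : T p -> rectangle u0 u1 v0 v1 p ->
    rectangle u0 u1 v0 v1 q ->
    (p.1 + p.2 = q.1 + q.2 /\ (p.1 + p.2 = u0 \/ p.1 + p.2 = u1)) \/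
    (p.1 - p.2 = q.1 - q.2 /\ (p.1 - p.2 = v0 \/ p.1 - p.2 = v1)) -> T q.
  (* Induction on the horizontal distance, which on a slanted side vanishes only for equal points;
     [(x1, x2)] is the diagonal step from [p] towards [q]. *)
  have [k] : exists k, `|p.1 - q.1|%N = k by eexists.
  elim: k p => [|k IH] p pqk Tp [/= pU pV] [/= qU qV] pq.
    by rewrite (_ : q = p) //; apply: Z2_eq; lia.
  pose x1 := if q.1 < p.1 then -1 else 1 : int.
  pose x2 := if q.2 < p.2 then -1 else 1 : int.
  have x1E : (q.1 < p.1 /\ x1 = -1) \/ (p.1 <= q.1 /\ x1 = 1).
    by rewrite /x1; case: ltP; [left|right].
  have x2E : (q.2 < p.2 /\ x2 = -1) \/ (p.2 <= q.2 /\ x2 = 1).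
    by rewrite /x2; case: ltP; [left|right].
  apply: (IH (p.1 + x1, p.2 + x2)) => /=; first lia.
  - by apply: (Tstep p) => //; split; [split=> /=; lia | move=> /=; lia].
  - by split=> /=; lia.
  - by split=> /=; lia.
  - by lia.
have Tw : T w.
  have [/= [oU oV]] := bo; move=> [|[|[|]]] ho.
  - by apply: (side o w) => //; [split=> /=; lia | lia].
  - apply: (side n w) => //; [|split=> /=; lia|split=> /=; lia|lia].
    by apply: (side o n) => //; [split=> /=; lia | lia].
  - by apply: (side o w) => //; [split=> /=; lia | lia].
  - apply: (side s w) => //; [|split=> /=; lia|split=> /=; lia|lia].
    by apply: (side o s) => //; [split=> /=; lia | lia].
have Tn : T n by apply: (side w n) => //; [split=> /=; lia|split=> /=; lia|lia].
have Ts : T s by apply: (side w s) => //; [split=> /=; lia|split=> /=; lia|lia].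
move=> q [/= [qU qV]]; move=> [|[|[|]]] hq.
- by apply: (side w q) => //; [split=> /=; lia | lia].
- by apply: (side n q) => //; [split=> /=; lia | lia].
- by apply: (side w q) => //; [split=> /=; lia | lia].
- by apply: (side s q) => //; [split=> /=; lia | lia].
Qed.


(** * Closed curves with slanted edges *)

Section Curve.

Context (s : nat -> Z2) (m : nat) (cs : closed_curve s m).
Local Notation t := (cyc s m).

Lemma cyc_inj i j : (0 < m)%N -> t i = t j -> i = j %[mod m].
Proof.
move=> m0; rewrite /cyc; set a := (i %% m)%N; set b := (j %% m)%N.
have [am bm] : (a < m /\ b < m)%N by rewrite !ltn_pmod.
have [_ _ inj] := cs => sab.
have [ab|ba|//] := ltngtP a b.
- by case: (inj a b) => //; lia.
- by case: (inj b a) => //; lia.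
Qed.

Lemma cyc_mod_succ i : (0 < m)%N -> t i.+1 = s (i %% m).+1.
Proof.
move=> m0; have am : (i %% m < m)%N by rewrite ltn_pmod.
have [_ s0m _] := cs.
rewrite /cyc -addn1 -modnDml addn1.
have [->|ne] := eqVneq (i %% m).+1 m; first by rewrite modnn.
by rewrite modn_small //; lia.
Qed.

(** A path may stall, but on a closed curve a stall would identify consecutive indices modulo
    [m]. *)
Lemma cyc_step i : (1 < m)%N -> c2 (t i) (t i.+1).
Proof.
move=> m1; have m0 := ltnW m1.
have am : (i %% m < m)%N by rewrite ltn_pmod.
have [path_s _ _] := cs.
have [e|] := path_s (i %% m)%N am; last by rewrite -cyc_mod_succ.
rewrite -cyc_mod_succ // in e; have /cyc_inj := e => /(_ m0) /eqP.
by rewrite -{1}[i]addn0 -addn1 eqn_modDl mod0n modn_small.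
Qed.

(** The bound matters: a curve of length 2 goes to a neighbor and back. *)
Lemma cyc_no_return i : (2 < m)%N -> t i <> t i.+2.
Proof.
move=> m2 /cyc_inj-/(_ ltac:(lia)) /eqP.
by rewrite -{1}[i]addn0 -addn2 eqn_modDl mod0n modn_small.
Qed.

Lemma cyc_trace i : (0 < m)%N -> trace s m (t i).
Proof. by move=> m0; exists (i %% m)%N => //; rewrite ltnW // ltn_pmod. Qed.

(** The index is a successor so that the point has both a predecessor and a successor on the
    curve. *)
Lemma traceP p : (0 < m)%N -> trace s m p -> exists i, t i.+1 = p.
Proof.
move=> m0 [i leim <-]; have [_ s0m _] := cs.
exists (i + m).-1; rewrite prednK; last by lia.
rewrite /cyc modnDr; move: leim; rewrite leq_eqVlt => /orP[/eqP->|ltim].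
  by rewrite modnn.
by rewrite modn_small.
Qed.

Lemma curve_segment_trace E : (0 < m)%N ->
  curve_segment s m E -> E `<=` trace s m.
Proof. by move=> m0 [_ [a [l ->]]] _ [j _ <-]; apply: cyc_trace. Qed.

(** Among the curve segments containing [E0], one that meets the most indices is maximal: segments
    lie in the trace, so equal index sets mean equal segments. *)
Lemma edge_of_segment E0 : (0 < m)%N -> curve_segment s m E0 ->
  exists2 E, edge s m E & E0 `<=` E.
Proof.
move=> m0 E0seg.
pose count E := #|[set i : 'I_m | `[< E (s i) >]]|%SET.
pose P k := `[< exists E, [/\ curve_segment s m E, E0 `<=` E & count E = k] >].
have exP : exists k, P k by exists (count E0); apply/asboolP; exists E0; split.
have ubP k : P k -> (k <= m)%N.
  move=> /asboolP[E [_ _ <-]]; rewrite -[leqRHS]card_ord; exact: max_card.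
have [k /asboolP[E [Eseg E0E <-]] maxk] := ex_maxnP exP ubP.
exists E => //; split=> // E' E'seg EE'.
have le : (count E' <= count E)%N.
  by apply: maxk; apply/asboolP; exists E'; split=> // p /E0E /EE'.
have sub : [set i : 'I_m | `[< E (s i) >]]%SET \subset
    [set i : 'I_m | `[< E' (s i) >]]%SET.
  by apply/fintype.subsetP => i; rewrite !inE; apply: EE'.
have eqEE' : [set i : 'I_m | `[< E (s i) >]]%SET =
    [set i : 'I_m | `[< E' (s i) >]]%SET.
  by apply/eqP; rewrite eqEcard sub.
rewrite eqEsubset; split=> // p E'p.
have [i] := traceP m0 (curve_segment_trace m0 E'seg E'p).
rewrite /cyc => ip; have im : (i.+1 %% m < m)%N by rewrite ltn_pmod.
have := congr1 (fun A : {set 'I_m} => Ordinal im \in A) eqEE'.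
by rewrite !inE /= ip => e; apply: asboolW; rewrite e; apply: asboolT.
Qed.

Lemma edge_of_step i : (1 < m)%N -> exists E, [/\ edge s m E, E (t i) & E (t i.+1)].
Proof.
move=> m1; have m0 := ltnW m1.
have adj := cyc_step i m1; have [ne _ _] := (c2P _ _).1 adj.
pose E0 := [set p | exists2 j, (j <= 1)%N & t (i + j)%N = p].
have E0i : E0 (t i) by exists 0%N; rewrite ?addn0.
have E0i1 : E0 (t i.+1) by exists 1%N; rewrite ?addn1.
have E0P p : E0 p -> p = t i \/ p = t i.+1.
  by move=> [[|[|//]] _ <-]; rewrite ?addn0 ?addn1; [left|right].
have [|E Eedge E0E] := @edge_of_segment E0 m0.
  split; last by exists i, 1%N.
  split; last by exists (t i), (t i.+1).
  - exists ((t i.+1).2 - (t i).2), ((t i).1 - (t i.+1).1),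
      (((t i.+1).2 - (t i).2) * (t i).1 + ((t i).1 - (t i.+1).1) * (t i).2).
    split; first by apply/eqP => e; apply: ne;
      have /= e1 := congr1 fst e; have /= e2 := congr1 snd e; apply: Z2_eq; lia.
    by move=> p /E0P[] -> //; lia.
  - right=> p q /E0P[] -> /E0P[] ->; try exact: joined_refl.
    + exact: joined_step.
    + by apply: joined_step; rewrite // c2_sym.
by exists E; split=> //; apply: E0E.
Qed.

Lemma edge_two_points E : edge s m E -> exists p q, [/\ E p, E q & p <> q].
Proof. by move=> [[[]]]. Qed.

Lemma edge_trace E : (0 < m)%N -> edge s m E -> E `<=` trace s m.
Proof. by move=> m0 [? _]; apply: curve_segment_trace. Qed.

(** On a curve of length at most 2 the trace has at most two points, and an edge, having two, is all
    of it. *)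
Lemma two_edges_long E E' : (0 < m)%N -> edge s m E -> edge s m E' -> E <> E' ->
  (2 < m)%N.
Proof.
move=> m0 eE eE' neq; rewrite ltnNge; apply/negP => m2; apply: neq.
have traceE p : trace s m p -> p = t 0 \/ p = t 1.
  move=> [i im <-]; have [_ s0m _] := cs.
  rewrite /cyc mod0n.
  case: (m) m0 m2 im s0m => [//|[|[|//]]] _ _; rewrite ?modn1 ?modn_small //.
    by case: i => [|[|//]] _ e; left.
  by case: i => [|[|[|//]]] _ e; rewrite -?e; [left|right|left].
have full E1 : edge s m E1 -> E1 = trace s m.
  move=> e1; have sub := edge_trace m0 e1; rewrite eqEsubset; split=> // r.
  have [p [q [Ep Eq pq]]] := edge_two_points e1.
  move: (pq) (Ep) (Eq); move: (traceE _ (sub _ Ep)) (traceE _ (sub _ Eq)).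
  by move=> [->|->] [->|->] // _ ? ? /traceE[->|->].
by rewrite (full _ eE) (full _ eE').
Qed.

Context (slant : all_sides_slanted s m) (long : (2 < m)%N).

Let m0 : (0 < m)%N. Proof. exact: leq_trans long. Qed.
Let m1 : (1 < m)%N. Proof. exact: ltnW. Qed.

Lemma slanted_step i :
  (t i).1 + (t i).2 = (t i.+1).1 + (t i.+1).2 /\
    ((t i).1 - (t i.+1).1 = 1 \/ (t i).1 - (t i.+1).1 = -1) \/
  (t i).1 - (t i).2 = (t i.+1).1 - (t i.+1).2 /\
    ((t i).1 - (t i.+1).1 = 1 \/ (t i).1 - (t i.+1).1 = -1).
Proof.
have [E [eE Ei Ei1]] := edge_of_step i m1.
have /c2P[/Z2_neq ne d1 d2] := cyc_step i m1.
have [[c Ec]|[c Ec]] := slant eE; have := Ec _ Ei; have := Ec _ Ei1; lia.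
Qed.

(** A slanted step changes U by 0, 2 or -2, so the parity of U is constant along the curve. This is
    what makes the four corners integer points. *)
Lemma trace_parity i j : exists c : int,
  (t j).1 + (t j).2 = (t i).1 + (t i).2 + 2 * c.
Proof.
suff from0 k : exists c : int, (t k).1 + (t k).2 = (t 0).1 + (t 0).2 + 2 * c.
  by have [c ec] := from0 i; have [d ed] := from0 j; exists (d - c); lia.
elim: k => [|k [c ec]]; first by exists 0; lia.
have [[e _]|[e [d|d]]] := slanted_step k.
- by exists c; lia.
- by exists (c - 1); lia.
- by exists (c + 1); lia.
Qed.

(* At a maximum of [h] along the curve, [h] cannot change both before and after,
   since the curve would then turn back. *)
Lemma extremal_edge (a b : int) : a = 1 \/ a = -1 -> b = 1 \/ b = -1 ->
  exists E M, [/\ edge s m E, forall p, E p -> a * p.1 + b * p.2 = M &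
    forall p, trace s m p -> a * p.1 + b * p.2 <= M].
Proof.
move=> a1 b1; pose h (p : Z2) : int := a * p.1 + b * p.2.
pose i0 : 'I_m := Ordinal m0.
case: (@Order.TotalTheory.arg_maxP _ _ _ i0 xpredT (fun i : 'I_m => h (s i)) isT).
move=> k _ maxk.
(* Shifting the index by [m] keeps the point and provides a predecessor. *)
have max_t j : h (t j) <= h (t (k + m)).
  rewrite {2}/cyc modnDr modn_small //.
  have jm : (j %% m < m)%N by rewrite ltn_pmod.
  exact: (maxk (Ordinal jm)).
have [i [iM i1M]] : exists i, h (t i) = h (t (k + m)) /\ h (t i.+1) = h (t (k + m)).
  have k1 : (k + m).-1.+1 = (k + m)%N by lia.
  have [e|ne] := eqVneq (h (t (k + m).+1)) (h (t (k + m))); first by exists (k + m)%N.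
  exists (k + m).-1; rewrite k1; split=> //.
  have := max_t (k + m).-1; have := max_t (k + m).+1.
  have := slanted_step (k + m); have := slanted_step (k + m).-1.
  have := @cyc_no_return (k + m).-1 long; rewrite k1 => /Z2_neq.
  rewrite /h in ne *; move: ne.
  by case: a1 => ->; case: b1 => ->; rewrite ?mulN1r ?mul1r; lia.
have [E [eE Ei Ei1]] := edge_of_step i m1.
exists E, (h (t (k + m))); split=> //; last first.
  by move=> p /(traceP m0)[j <-]; apply: max_t.
(* The edge contains a step along which [h] is constant, so the slanted line carrying it is a level
   line of [h]. *)
move=> p Ep; rewrite -iM; move: i1M; rewrite -iM.
have /c2P[/Z2_neq ne d1 d2] := cyc_step i m1.
rewrite /h; have [[c Ec]|[c Ec]] := slant eE;
  have := Ec _ Ei; have := Ec _ Ei1; have := Ec _ Ep.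
all: by case: a1 => ->; case: b1 => ->; rewrite ?mulN1r ?mul1r; lia.
Qed.

End Curve.

(** * From four slanted edges to the rectangle *)

(** An injection into [I_4] reduces this to the pigeonhole principle for five numbers below 4. *)
Lemma four_elements (T : Type) (A : set T) (a b c d x : T) : (A #= `I_4)%card ->
    A a -> A b -> A c -> A d -> a <> b -> a <> c -> a <> d ->
    b <> c -> b <> d -> c <> d -> A x ->
  x = a \/ x = b \/ x = c \/ x = d.
Proof.
move=> /card_set_bijP[f [fA f_inj _]] Aa Ab Ac Ad ab ac ad bc bd cd Ax.
have fI y : A y -> (f y < 4)%N by move=> Ay; apply: fA.
have f_eq y z : A y -> A z -> f y = f z -> y = z.
  by move=> Ay Az; apply: f_inj; rewrite inE.
have f_neq y z : A y -> A z -> y <> z -> f y <> f z.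
  by move=> Ay Az yz /(f_eq _ _ Ay Az).
have := f_neq _ _ Aa Ab ab; have := f_neq _ _ Aa Ac ac.
have := f_neq _ _ Aa Ad ad; have := f_neq _ _ Ab Ac bc.
have := f_neq _ _ Ab Ad bd; have := f_neq _ _ Ac Ad cd.
have := fI _ Aa; have := fI _ Ab; have := fI _ Ac; have := fI _ Ad.
have := fI _ Ax => ? ? ? ? ? ? ? ? ? ? ?.
have [e|[e|[e|e]]] : f x = f a \/ f x = f b \/ f x = f c \/ f x = f d by lia.
- by left; apply: f_eq.
- by right; left; apply: f_eq.
- by right; right; left; apply: f_eq.
- by right; right; right; apply: f_eq.
Qed.

Lemma four_sided_two_edges s m : four_sided s m ->
  exists E E', [/\ edge s m E, edge s m E' & E <> E'].
Proof.
move=> /card_set_bijP[f [_ _ f_surj]].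
have [E eE fE] := f_surj 0%N isT; have [E' eE' fE'] := f_surj 1%N isT.
by exists E, E'; split=> // e; move: fE; rewrite e fE'.
Qed.

(** For [m = 0] the trace is one point, and every other point has a vertical ray avoiding it, so no
    component could be finite. *)
Lemma splits_plane_nontrivial s m : splits_plane (trace s m) -> (0 < m)%N.
Proof.
move=> /Int_nonempty[p Ip]; rewrite lt0n; apply/eqP => m0.
have S0 q : trace s m q -> q = s 0%N.
  by rewrite m0 => -[i]; rewrite leqn0 => /eqP-> <-.
have neq : p <> s 0%N.
  by move=> e; apply: (Int_outside Ip); rewrite e; exists 0%N.
have [ne|ne] := Z2_neq neq.
- apply: (@ray_not_Int _ p (0, 1) _ _ Ip) => // k /S0 e.
  by have /= := congr1 fst e; lia.
- have [lt|le] := ltP (s 0%N).2 p.2.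
  + apply: (@ray_not_Int _ p (0, 1) _ _ Ip) => // k /S0 e.
    by have /= := congr1 snd e; lia.
  + apply: (@ray_not_Int _ p (0, -1) _ _ Ip) => // k /S0 e.
    by have /= := congr1 snd e; lia.
Qed.

Lemma slanted_four_sided_rectangle s m : closed_curve s m -> (0 < m)%N ->
    four_sided s m -> all_sides_slanted s m ->
  exists u0 u1 v0 v1 : int, [/\ u0 < u1, v0 < v1,
    (exists p : Z2, p.1 + p.2 = u0 /\ p.1 - p.2 = v0),
    (exists p : Z2, p.1 + p.2 = u1 /\ p.1 - p.2 = v1) &
    [/\ exists p : Z2, p.1 + p.2 = u1 /\ p.1 - p.2 = v0,
        exists p : Z2, p.1 + p.2 = u0 /\ p.1 - p.2 = v1,
        trace s m = rectangle_boundary u0 u1 v0 v1 &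
        edge_endpoints s m = corners u0 u1 v0 v1]].
Proof.
move=> cs m0 four slant.
have [E [E' [eE eE' neq]]] := four_sided_two_edges four.
have long := two_edges_long cs m0 eE eE' neq.
have m1 : (1 < m)%N by apply: ltnW.
have one : (1 : int) = 1 \/ (1 : int) = -1 by left.
have mone : (-1 : int) = 1 \/ (-1 : int) = -1 by right.
(* The four sign choices give U, -U, V and -V; minima arise as maxima of the opposites, hence the
   negated [u0'] and [v0']. *)
have [EU1 [u1 [eU1 U1 maxU]]] := extremal_edge cs slant long one one.
have [EU0 [u0' [eU0 U0 minU]]] := extremal_edge cs slant long mone mone.
have [EV1 [v1 [eV1 V1 maxV]]] := extremal_edge cs slant long one mone.
have [EV0 [v0' [eV0 V0 minV]]] := extremal_edge cs slant long mone one.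
have [u0 eu0] : exists u0, u0' = - u0 by exists (- u0'); lia.
have [v0 ev0] : exists v0, v0' = - v0 by exists (- v0'); lia.
subst u0' v0'.
have [pU1 [qU1 [pU1E qU1E /Z2_neq pqU1]]] := edge_two_points eU1.
have [pU0 [qU0 [pU0E qU0E /Z2_neq pqU0]]] := edge_two_points eU0.
have [pV1 [qV1 [pV1E qV1E /Z2_neq pqV1]]] := edge_two_points eV1.
have [pV0 [qV0 [pV0E qV0E /Z2_neq pqV0]]] := edge_two_points eV0.
have bounds p : trace s m p -> rectangle u0 u1 v0 v1 p.
  move=> Tp; have := maxU _ Tp; have := minU _ Tp; have := maxV _ Tp.
  by have := minV _ Tp => ? ? ? ?; split=> /=; lia.
have inT F p : edge s m F -> F p -> trace s m p.
  by move=> eF; apply: edge_trace.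
have ltu : u0 < u1.
  have [/= ? ?] := bounds _ (inT _ _ eV1 pV1E).
  have [/= ? ?] := bounds _ (inT _ _ eV1 qV1E).
  by have := V1 _ pV1E; have := V1 _ qV1E; lia.
have ltv : v0 < v1.
  have [/= ? ?] := bounds _ (inT _ _ eU1 pU1E).
  have [/= ? ?] := bounds _ (inT _ _ eU1 qU1E).
  by have := U1 _ pU1E; have := U1 _ qU1E; lia.
(* Opposite extremal edges lie on distinct parallel lines, and an edge, having two points, cannot
   lie on lines of both slopes; so the four are distinct and are all the edges. *)
have sides F : edge s m F -> F = EU1 \/ F = EU0 \/ F = EV1 \/ F = EV0.
  apply: (four_elements four) => // e.
  - by have := U1 _ pU1E; rewrite e in pU1E; have := U0 _ pU1E; lia.
  - have := U1 _ pU1E; have := U1 _ qU1E; rewrite e in pU1E qU1E.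
    by have := V1 _ pU1E; have := V1 _ qU1E; lia.
  - have := U1 _ pU1E; have := U1 _ qU1E; rewrite e in pU1E qU1E.
    by have := V0 _ pU1E; have := V0 _ qU1E; lia.
  - have := U0 _ pU0E; have := U0 _ qU0E; rewrite e in pU0E qU0E.
    by have := V1 _ pU0E; have := V1 _ qU0E; lia.
  - have := U0 _ pU0E; have := U0 _ qU0E; rewrite e in pU0E qU0E.
    by have := V0 _ pU0E; have := V0 _ qU0E; lia.
  - by have := V1 _ pV1E; rewrite e in pV1E; have := V0 _ pV1E; lia.
clear pqU1 pqU0 pqV1 pqV0.
have step i : boundary_step u0 u1 v0 v1 (cyc s m i) (cyc s m i.+1).
  split; first by apply/bounds/cyc_trace.
  have [F [eF Fi Fi1]] := edge_of_step cs i m1.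
  have d := slanted_step cs slant long i.
  have [e|[e|[e|e]]] := sides _ eF; rewrite e in Fi Fi1.
  - by have := U1 _ Fi; have := U1 _ Fi1; lia.
  - by have := U0 _ Fi; have := U0 _ Fi1; lia.
  - by have := V1 _ Fi; have := V1 _ Fi1; lia.
  - by have := V0 _ Fi; have := V0 _ Fi1; lia.
have back i : boundary_step u0 u1 v0 v1 (cyc s m i.+1) (cyc s m i).
  by have [_ h] := step i; split; [apply/bounds/cyc_trace | lia].
have corner (a b : Z2) : trace s m a -> trace s m b ->
    exists p : Z2, p.1 + p.2 = a.1 + a.2 /\ p.1 - p.2 = b.1 - b.2.
  move=> /(traceP cs m0)[i <-] /(traceP cs m0)[j <-].
  have [c ec] := trace_parity cs slant long i.+1 j.+1.
  set a' := cyc s m i.+1 in ec *; set b' := cyc s m j.+1 in ec *.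
  by exists (a'.1 + a'.2 + c - b'.2, b'.2 - c) => /=; lia.
have TU1 := inT _ _ eU1 pU1E; have TU0 := inT _ _ eU0 pU0E.
have TV1 := inT _ _ eV1 pV1E; have TV0 := inT _ _ eV0 pV0E.
have left_corner : exists p : Z2, p.1 + p.2 = u0 /\ p.1 - p.2 = v0.
  have [p hp] := corner _ _ TU0 TV0; exists p.
  by have := U0 _ pU0E; have := V0 _ pV0E; lia.
have right_corner : exists p : Z2, p.1 + p.2 = u1 /\ p.1 - p.2 = v1.
  have [p hp] := corner _ _ TU1 TV1; exists p.
  by have := U1 _ pU1E; have := V1 _ pV1E; lia.
have top_corner : exists p : Z2, p.1 + p.2 = u1 /\ p.1 - p.2 = v0.
  have [p hp] := corner _ _ TU1 TV0; exists p.
  by have := U1 _ pU1E; have := V0 _ pV0E; lia.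
have bottom_corner : exists p : Z2, p.1 + p.2 = u0 /\ p.1 - p.2 = v1.
  have [p hp] := corner _ _ TU0 TV1; exists p.
  by have := U0 _ pU0E; have := V1 _ pV1E; lia.
have trace_sub : trace s m `<=` rectangle_boundary u0 u1 v0 v1.
  move=> p Tp; split; first exact: bounds.
  by have [i <-] := traceP cs m0 Tp; have [_] := step i.+1; lia.
have traceE : trace s m = rectangle_boundary u0 u1 v0 v1.
  rewrite eqEsubset; split=> //; apply: boundary_saturated => //; last first.
    by exists pU1; split=> //; apply: trace_sub.
  (* The curve passes through [p] from one boundary neighbor to a different one, and there are no
     others. *)
  move=> p q Tp pq; have [i ip] := traceP cs m0 Tp; rewrite -ip in Tp pq.
  have [->|->] := boundary_step_two ltu ltv (bounds _ Tp) (back i) (step i.+1)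
    (@cyc_no_return _ _ cs i long) pq; exact: cyc_trace.
have inX q : rectangle u0 u1 v0 v1 q ->
    q.1 + q.2 = u0 \/ q.1 + q.2 = u1 \/ q.1 - q.2 = v0 \/ q.1 - q.2 = v1 ->
    trace s m q.
  by move=> Xq bq; rewrite traceE.
(* If [p] lies on a bounding U-line, so does one of its curve neighbors, as otherwise both would be
   the same inward neighbor. The edge through that step is [EU1] or [EU0]; likewise for V. Hence
   each extremal edge is a whole side. *)
have along (p : Z2) : trace s m p ->
    (p.1 + p.2 = u0 \/ p.1 + p.2 = u1 -> EU1 p \/ EU0 p) /\
    (p.1 - p.2 = v0 \/ p.1 - p.2 = v1 -> EV1 p \/ EV0 p).
  move=> Tp; have [i ip] := traceP cs m0 Tp.
  have [/= pU pV] := bounds _ Tp.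
  have [[/= aU aV] pa] := back i; have [[/= bU bV] pb] := step i.+1.
  have := @cyc_no_return _ _ cs i long => /Z2_neq ab.
  have [F [eF Fa Fp]] := edge_of_step cs i m1.
  have [G [eG Gp Gb]] := edge_of_step cs i.+1 m1.
  rewrite ip in pa pb Fp Gp.
  have sF := sides _ eF; have sG := sides _ eG.
  split=> h.
  - have [e|e] : p.1 + p.2 = (cyc s m i).1 + (cyc s m i).2 \/
        p.1 + p.2 = (cyc s m i.+2).1 + (cyc s m i.+2).2.
      by lia.
    + have [e1|[e1|[e1|e1]]] := sF; rewrite e1 in Fa Fp; [by left|by right| |].
      * by have := V1 _ Fa; have := V1 _ Fp; lia.
      * by have := V0 _ Fa; have := V0 _ Fp; lia.
    + have [e1|[e1|[e1|e1]]] := sG; rewrite e1 in Gb Gp; [by left|by right| |].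
      * by have := V1 _ Gb; have := V1 _ Gp; lia.
      * by have := V0 _ Gb; have := V0 _ Gp; lia.
  - have [e|e] : p.1 - p.2 = (cyc s m i).1 - (cyc s m i).2 \/
        p.1 - p.2 = (cyc s m i.+2).1 - (cyc s m i.+2).2.
      by lia.
    + have [e1|[e1|[e1|e1]]] := sF; rewrite e1 in Fa Fp; [| |by left|by right].
      * by have := U1 _ Fa; have := U1 _ Fp; lia.
      * by have := U0 _ Fa; have := U0 _ Fp; lia.
    + have [e1|[e1|[e1|e1]]] := sG; rewrite e1 in Gb Gp; [| |by left|by right].
      * by have := U1 _ Gb; have := U1 _ Gp; lia.
      * by have := U0 _ Gb; have := U0 _ Gp; lia.
have inU1 p : rectangle u0 u1 v0 v1 p -> p.1 + p.2 = u1 -> EU1 p.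
  move=> Xp pu; have [|/(_ ltac:(lia))[//|/U0 e] _] := along p; last lia.
  by apply: inX => //; lia.
have inU0 p : rectangle u0 u1 v0 v1 p -> p.1 + p.2 = u0 -> EU0 p.
  move=> Xp pu; have [|/(_ ltac:(lia))[/U1 e|//] _] := along p; last lia.
  by apply: inX => //; lia.
have inV1 p : rectangle u0 u1 v0 v1 p -> p.1 - p.2 = v1 -> EV1 p.
  move=> Xp pv; have [|_ /(_ ltac:(lia))[//|/V0 e]] := along p; last lia.
  by apply: inX => //; lia.
have inV0 p : rectangle u0 u1 v0 v1 p -> p.1 - p.2 = v0 -> EV0 p.
  move=> Xp pv; have [|_ /(_ ltac:(lia))[/V1 e|//]] := along p; last lia.
  by apply: inX => //; lia.
exists u0, u1, v0, v1; split=> //; split=> //.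
have [w [wu wv]] := left_corner; have [e [eu ev]] := right_corner.
have [n [nu nv]] := top_corner; have [b [bu bv]] := bottom_corner.
rewrite eqEsubset; split=> p.
- move=> [F eF [Fp not_mid]].
  have [/= pU pV] := bounds _ (inT _ _ eF Fp).
  (* Between corners, a point of a side is the midpoint of its two neighbors on that side, which by
     parity stay in the rectangle. *)
  have Umid : p.1 + p.2 = u0 \/ p.1 + p.2 = u1 -> F = EU1 \/ F = EU0 ->
      p.1 - p.2 = v0 \/ p.1 - p.2 = v1.
    move=> pu hF; apply: contrapT => nv'; apply: not_mid; exists (1, -1).
    case: hF => hF; rewrite hF in Fp *.
    + have := U1 _ Fp => fp.
      split=> //; [apply: inU1|apply: inU1]; rewrite /=; try split=> /=; lia.
    + have := U0 _ Fp => fp.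
      split=> //; [apply: inU0|apply: inU0]; rewrite /=; try split=> /=; lia.
  have Vmid : p.1 - p.2 = v0 \/ p.1 - p.2 = v1 -> F = EV1 \/ F = EV0 ->
      p.1 + p.2 = u0 \/ p.1 + p.2 = u1.
    move=> pv hF; apply: contrapT => nu'; apply: not_mid; exists (1, 1).
    case: hF => hF; rewrite hF in Fp *.
    + have := V1 _ Fp => fp.
      split=> //; [apply: inV1|apply: inV1]; rewrite /=; try split=> /=; lia.
    + have := V0 _ Fp => fp.
      split=> //; [apply: inV0|apply: inV0]; rewrite /=; try split=> /=; lia.
  have [hF|[hF|[hF|hF]]] := sides _ eF.
  + have h : p.1 + p.2 = u0 \/ p.1 + p.2 = u1.
      by have := U1 p; rewrite -hF => /(_ Fp); lia.
    by split=> //; apply: Umid => //; left.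
  + have h : p.1 + p.2 = u0 \/ p.1 + p.2 = u1.
      by have := U0 p; rewrite -hF => /(_ Fp); lia.
    by split=> //; apply: Umid => //; right.
  + have h : p.1 - p.2 = v0 \/ p.1 - p.2 = v1.
      by have := V1 p; rewrite -hF => /(_ Fp); lia.
    by split=> //; apply: Vmid => //; left.
  + have h : p.1 - p.2 = v0 \/ p.1 - p.2 = v1.
      by have := V0 p; rewrite -hF => /(_ Fp); lia.
    by split=> //; apply: Vmid => //; right.
- move=> [/= pu pv]; have Xp : rectangle u0 u1 v0 v1 p by split=> /=; lia.
  (* At a corner V is extremal, so on a U-edge two points [p + d] and [p - d] within the bounds
     force [d = 0]. *)
  have noMid F : edge s m F -> (forall q : Z2, F q -> q.1 + q.2 = p.1 + p.2) ->
      ~ exists d : Z2, [/\ d != 0, F (p + d) & F (p - d)].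
    move=> eF FU [d [/eqP dn0 Fd1 Fd2]]; apply: dn0.
    have := FU _ Fd1; have [/= ? ?] := bounds _ (inT _ _ eF Fd1).
    have := FU _ Fd2; have [/= ? ?] := bounds _ (inT _ _ eF Fd2).
    by move=> ? ?; apply: Z2_eq => /=; lia.
  have [e0|e1] := pu.
  + exists EU0 => //; split; first exact: inU0.
    by apply: noMid => // q /U0; lia.
  + exists EU1 => //; split; first exact: inU1.
    by apply: noMid => // q /U1; lia.
Qed.

Theorem proposition7p1 (X : set Z2) (s : nat -> Z2) (m : nat)
    (X_bounded_by_s : bounding_curve X s m)
    (X_four_sided : four_sided s m)
    (X_slanted : all_sides_slanted s m)
    (X_thick : thick X) :
  minimal_cold_set c2 X (edge_endpoints s m).
Proof.
have [cs split_s ->] := X_bounded_by_s.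
have m0 := splits_plane_nontrivial split_s.
have [u0 [u1 [v0 [v1 [ltu ltv w e [n b tr ->]]]]]] :=
  slanted_four_sided_rectangle cs m0 X_four_sided X_slanted.
(* The boundary and the open rectangle, which is its [Int], make up the closed rectangle. *)
rewrite tr (_ : _ `|` _ = rectangle u0 u1 v0 v1).
  exact: rectangle_minimal_cold.
rewrite eqEsubset; split=> p.
  by move=> [[]//|/Int_rectangle_boundary[? ?]]; split=> /=; lia.
move=> [/= pU pV].
have [in_p|] := pselect (u0 < p.1 + p.2 < u1 /\ v0 < p.1 - p.2 < v1).
  by right; apply/Int_rectangle_boundary.
by move=> out; left; split; [|lia].
Qed.
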